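(* Let $n\ge 1$ be an integer and let $V(n)$ be the $\mathbb{Q}$-vector space with basis $\phi_0,\ldots,\phi_{n-1}$. The operators $\{\alpha_i^+\}_{i=0}^{n-1}$ (left wedge multiplication by $\phi_i$) and $\{\hat\alpha_i^-\}_{i=0}^{n-1}$ (left partial derivative $\partial_i^L$) on $\bigwedge^*(V(n))$ satisfy, for all $0\le i,j\le n-1$: (1) $\alpha_i^+\alpha_j^++\alpha_j^+\alpha_i^+=0$; (2) $\hat\alpha_i^-\hat\alpha_j^-+\hat\alpha_j^-\hat\alpha_i^-=0$; (3) $\alpha_i^+\hat\alpha_j^-+\hat\alpha_j^-\alpha_i^+=\delta_{i,j}$ (times the identity).
   Context: $\bigwedge^*(V(n))$ has basis the monomials $\phi_{k_1}\wedge\cdots\wedge\phi_{k_d}$ with $0\le k_1<\cdots<k_d\le n-1$, $0\le d\le n$. $\alpha_i^+(P)=\phi_i\wedge P$. The left partial derivative $\partial_i^L$ is the linear operator such that, for $k_1<\cdots<k_d$, if $i=k_s$ then $\partial_i^L(\phi_{k_1}\wedge\cdots\wedge\phi_{k_d})=(-1)^{s-1}\phi_{k_1}\wedge\cdots\wedge\widehat{\phi_{k_s}}\wedge\cdots\wedge\phi_{k_d}$, and if $i\notin\{k_1,\ldots,k_d\}$ then $\partial_i^L(\phi_{k_1}\wedge\cdots\wedge\phi_{k_d})=0$. $\hat\alpha_i^-=\partial_i^L$. *)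

(* Defs.v *)
From HB Require Import structures.
From mathcomp Require Import all_boot all_order all_algebra.

Set Implicit Arguments.
Unset Strict Implicit.
Unset Printing Implicit Defensive.

Import GRing.Theory.

Local Open Scope ring_scope.

(* The exterior algebra of V(n) = Q^n (row vectors 'rV[rat]_n, phi_i being the
   i-th unit vector). The monomial basis is indexed by the subsets
   S = {k_1 < ... < k_d} of 'I_n; an element is its family of coordinates. *)
Definition extalg (n : nat) : Type := {ffun {set 'I_n} -> rat^o}.

HB.instance Definition _ (n : nat) := Vector.on (extalg n).

Definition monom (n : nat) (S : {set 'I_n}) : extalg n :=
  [ffun T => (T == S)%:R].

(* number of transpositions needed to sort the concatenation of the increasing
   enumerations of S and T *)
Definition inversions (n : nat) (S T : {set 'I_n}) : nat :=
  (\sum_(i in S) \sum_(j in T) (j < i))%N.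

Definition wedge_sign (n : nat) (S T : {set 'I_n}) : rat :=
  if [disjoint S & T] then (-1) ^+ inversions S T else 0.

Definition wedge (n : nat) (P Q : extalg n) : extalg n :=
  \sum_(S : {set 'I_n}) \sum_(T : {set 'I_n})
    (P S * Q T * wedge_sign S T) *: monom (S :|: T).

Section ExteriorAlgebra.
Variable n : nat.
Implicit Types (P Q R : extalg n) (S T U : {set 'I_n}).

Lemma extalg_decomp P : P = \sum_S P S *: monom S.
Proof.
apply/ffunP => T; rewrite sum_ffunE (bigD1 T) //= big1 => [|S neST].
  by rewrite !ffunE eqxx addr0 [RHS]mulr1.
by rewrite !ffunE eq_sym (negbTE neST) [LHS]mulr0.
Qed.

Lemma wedgeDl : left_distributive (@wedge n) +%R.
Proof.
move=> P Q R; rewrite /wedge -big_split; apply: eq_bigr => S _.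
rewrite -big_split; apply: eq_bigr => T _.
by rewrite ffunE !mulrDl scalerDl.
Qed.

Lemma wedgeDr : right_distributive (@wedge n) +%R.
Proof.
move=> P Q R; rewrite /wedge -big_split; apply: eq_bigr => S _.
rewrite -big_split; apply: eq_bigr => T _.
by rewrite ffunE mulrDr mulrDl scalerDl.
Qed.

Lemma wedgeZl a P Q : a *: wedge P Q = wedge (a *: P) Q.
Proof.
rewrite /wedge scaler_sumr; apply: eq_bigr => S _.
rewrite scaler_sumr; apply: eq_bigr => T _.
by rewrite scalerA ffunE !mulrA.
Qed.

Lemma wedgeZr a P Q : a *: wedge P Q = wedge P (a *: Q).
Proof.
rewrite /wedge scaler_sumr; apply: eq_bigr => S _.
rewrite scaler_sumr; apply: eq_bigr => T _.
by rewrite scalerA ffunE !mulrA [a * P S]mulrC -!mulrA.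
Qed.

Lemma wedge0l Q : wedge 0 Q = 0.
Proof. by have := wedgeZl 0 0 Q; rewrite !scale0r. Qed.

Lemma wedge0r P : wedge P 0 = 0.
Proof. by have := wedgeZr 0 P 0; rewrite !scale0r. Qed.

Lemma wedge_suml I (r : seq I) (F : I -> extalg n) Q :
  wedge (\sum_(i <- r) F i) Q = \sum_(i <- r) wedge (F i) Q.
Proof.
elim: r => [|i r IH]; first by rewrite !big_nil wedge0l.
by rewrite !big_cons wedgeDl IH.
Qed.

Lemma wedge_sumr I (r : seq I) (F : I -> extalg n) P :
  wedge P (\sum_(i <- r) F i) = \sum_(i <- r) wedge P (F i).
Proof.
elim: r => [|i r IH]; first by rewrite !big_nil wedge0r.
by rewrite !big_cons wedgeDr IH.
Qed.

Lemma wedge_monom S T :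
  wedge (monom S) (monom T) = wedge_sign S T *: monom (S :|: T).
Proof.
rewrite /wedge (bigD1 S) //= (bigD1 T) //= !ffunE !eqxx mulr1 mul1r.
rewrite big1 ?addr0 => [|T' /negbTE neT].
  rewrite big1 ?addr0 // => S' /negbTE neS; rewrite big1 // => T' _.
  by rewrite !ffunE neS !mul0r scale0r.
by rewrite !ffunE neT mulr0 mul0r scale0r.
Qed.

Lemma inversionsUl S T U : [disjoint S & T] ->
  inversions (S :|: T) U = (inversions S U + inversions T U)%N.
Proof.
move=> dST; rewrite /inversions -bigU //=.
by apply: eq_bigl => i; rewrite inE.
Qed.

Lemma inversionsUr S T U : [disjoint T & U] ->
  inversions S (T :|: U) = (inversions S T + inversions S U)%N.
Proof.
move=> dTU; rewrite /inversions -big_split; apply: eq_bigr => i _ /=.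
by rewrite -bigU //=; apply: eq_bigl => j; rewrite inE.
Qed.

Lemma disjointUl S T U :
  [disjoint S :|: T & U] = [disjoint S & U] && [disjoint T & U].
Proof. by rewrite -!setI_eq0 setIUl setU_eq0. Qed.

Lemma disjointUr S T U :
  [disjoint S & T :|: U] = [disjoint S & T] && [disjoint S & U].
Proof. by rewrite -!setI_eq0 setIUr setU_eq0. Qed.

Lemma wedge_sign_cocycle S T U :
  wedge_sign T U * wedge_sign S (T :|: U)
  = wedge_sign S T * wedge_sign (S :|: T) U.
Proof.
rewrite /wedge_sign disjointUl disjointUr.
have [dTU|_] := boolP [disjoint T & U]; have [dST|_] := boolP [disjoint S & T];
  have [dSU|_] := boolP [disjoint S & U]; rewrite /= ?(mul0r, mulr0) //.
by rewrite inversionsUl // inversionsUr // !exprD mulrC -mulrA.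
Qed.

Lemma wedgeA : associative (@wedge n).
Proof.
move=> P Q R; rewrite (extalg_decomp P).
rewrite (wedge_suml _ _ Q) !(wedge_suml _ _ R, wedge_suml _ _ (wedge Q R)).
apply: eq_bigr => S _; rewrite -!wedgeZl; congr (_ *: _).
rewrite (extalg_decomp Q) (wedge_suml _ _ R) !(wedge_sumr _ _ (monom S)).
rewrite (wedge_suml _ _ R); apply: eq_bigr => T _.
rewrite -wedgeZl -!wedgeZr -wedgeZl; congr (_ *: _).
rewrite (extalg_decomp R) !(wedge_sumr _ _ (monom T)).
rewrite (wedge_sumr _ _ (monom S)) (wedge_sumr _ _ (wedge (monom S) (monom T))).
apply: eq_bigr => U _; rewrite -!wedgeZr; congr (_ *: _).
rewrite !wedge_monom -wedgeZl -wedgeZr !wedge_monom !scalerA setUA.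
by rewrite wedge_sign_cocycle.
Qed.

Lemma wedge1l : left_id (monom set0) (@wedge n).
Proof.
move=> P; rewrite (extalg_decomp P) wedge_sumr; apply: eq_bigr => S _.
rewrite -wedgeZr wedge_monom set0U /wedge_sign -setI_eq0 set0I eqxx.
by rewrite /inversions big_set0 scale1r.
Qed.

Lemma wedge1r : right_id (monom set0) (@wedge n).
Proof.
move=> P; rewrite (extalg_decomp P) wedge_suml; apply: eq_bigr => S _.
rewrite -wedgeZl wedge_monom setU0 /wedge_sign -setI_eq0 setI0 eqxx.
by rewrite /inversions big1 ?scale1r // => i _; rewrite big_set0.
Qed.

Lemma monom0_neq0 : monom set0 != 0 :> extalg n.
Proof.
by apply/eqP => /ffunP/(_ set0)/eqP; rewrite !ffunE eqxx oner_eq0.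
Qed.

End ExteriorAlgebra.

HB.instance Definition _ (n : nat) := GRing.Zmodule_isNzRing.Build (extalg n)
  (@wedgeA n) (@wedge1l n) (@wedge1r n) (@wedgeDl n) (@wedgeDr n)
  (monom0_neq0 n).

HB.instance Definition _ (n : nat) :=
  GRing.Lmodule_isLalgebra.Build rat (extalg n) (@wedgeZl n).

HB.instance Definition _ (n : nat) :=
  GRing.Lalgebra_isAlgebra.Build rat (extalg n) (@wedgeZr n).

Definition ext_incl (n : nat) (v : 'rV[rat]_n) : extalg n :=
  \sum_(i < n) v 0 i *: monom [set i].

Definition phi (n : nat) (i : 'I_n) : extalg n := ext_incl (delta_mx 0 i).

Lemma phiE (n : nat) (i : 'I_n) : phi i = monom [set i].
Proof.
rewrite /phi /ext_incl (bigD1 i) //= big1 => [|j /negbTE ne_ji].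
  by rewrite mxE !eqxx scale1r addr0.
by rewrite mxE eqxx ne_ji scale0r.
Qed.

(* Together with the basis of 2 ^ n ordered products given by monomE, the
   relations v ^ v = 0 identify extalg n with the exterior algebra of Q^n. *)
Lemma ext_incl_sq (n : nat) (v : 'rV[rat]_n) : ext_incl v * ext_incl v = 0.
Proof.
have anti (i j : 'I_n) :
    monom [set i] * monom [set j] = - (monom [set j] * monom [set i]).
  rewrite ![_ * _]wedge_monom /wedge_sign !disjoints1 !inE eq_sym setUC.
  case: (ltngtP i j) => [lt|lt|/val_inj->]; last by rewrite eqxx scale0r oppr0.
    rewrite -val_eqE gtn_eqF //= /inversions !big_set1 lt ltnNge (ltnW lt) /=.
    by rewrite expr1 scaleN1r opprK scale1r.
  rewrite -val_eqE ltn_eqF //= /inversions !big_set1 lt ltnNge (ltnW lt) /=.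
  by rewrite expr1 scaleN1r scale1r.
have sqE : ext_incl v * ext_incl v = \sum_(i < n) \sum_(j < n)
    (v 0 i * v 0 j) *: (monom [set i] * monom [set j]).
  rewrite mulr_suml; apply: eq_bigr => i _; rewrite mulr_sumr.
  by apply: eq_bigr => j _; rewrite -scalerAl -scalerAr scalerA.
have: ext_incl v * ext_incl v = - (ext_incl v * ext_incl v).
  rewrite {1}sqE exchange_big sqE -sumrN; apply: eq_bigr => i _ /=.
  rewrite -sumrN; apply: eq_bigr => j _.
  by rewrite anti scalerN mulrC.
move=> /eqP; rewrite -subr_eq0 opprK -mulr2n -scaler_nat scaler_eq0.
by move=> /orP[|/eqP].
Qed.

Lemma sorted_enum_ord (n : nat) (S : {set 'I_n}) :
  sorted (fun i j : 'I_n => (i < j)%N) (enum S).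
Proof.
rewrite /enum_mem; apply: sorted_filter.
  by move=> ? ? ?; apply: ltn_trans.
rewrite -enumT; have := iota_ltn_sorted 0 n.
by rewrite -val_enum_ord sorted_map.
Qed.

Lemma monomE (n : nat) (S : {set 'I_n}) :
  monom S = \prod_(k <- enum S) phi k.
Proof.
suff prodE (ks : seq 'I_n) : sorted (fun i j : 'I_n => (i < j)%N) ks ->
    \prod_(k <- ks) phi k = monom [set k in ks].
  rewrite prodE ?sorted_enum_ord //; congr monom.
  by apply/setP => k; rewrite inE mem_enum.
elim: ks => [_|k ks IH /= kks]; first by rewrite big_nil set_nil.
have /allP ltk : all (fun j : 'I_n => (k < j)%N) ks.
  by apply: order_path_min kks; move=> ? ? ?; apply: ltn_trans.
rewrite big_cons IH ?(path_sorted kks) // phiE [_ * _]wedge_monom set_cons.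
rewrite /wedge_sign disjoints1 inE /inversions big_set1.
have -> : k \notin ks by apply/negP => /ltk; rewrite ltnn.
rewrite big1 ?scale1r // => j; rewrite inE => /ltk ltkj.
by rewrite ltnNge (ltnW ltkj).
Qed.

Definition wedge_left (n : nat) (i : 'I_n) (P : extalg n) : extalg n :=
  phi i * P.

Fact wedge_left_is_linear (n : nat) (i : 'I_n) : linear (wedge_left i).
Proof. by move=> a P Q; rewrite /wedge_left mulrDr scalerAr. Qed.

HB.instance Definition _ (n : nat) (i : 'I_n) :=
  GRing.isLinear.Build rat (extalg n) (extalg n) *:%R (wedge_left i)
    (wedge_left_is_linear i).

(* [enum S] lists S increasingly, so for i = k_s the index below is s - 1. *)
Definition pderivL_monom (n : nat) (i : 'I_n) (S : {set 'I_n}) : extalg n :=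
  if i \in S then (-1) ^+ index i (enum S) *: monom (S :\ i) else 0.

Definition pderivL (n : nat) (i : 'I_n) (P : extalg n) : extalg n :=
  \sum_(S : {set 'I_n}) P S *: pderivL_monom i S.

Fact pderivL_is_linear (n : nat) (i : 'I_n) : linear (pderivL i).
Proof.
move=> a P Q; rewrite /pderivL scaler_sumr -big_split; apply: eq_bigr => S _.
by rewrite !ffunE scalerDl scalerA.
Qed.

HB.instance Definition _ (n : nat) (i : 'I_n) :=
  GRing.isLinear.Build rat (extalg n) (extalg n) *:%R (pderivL i)
    (pderivL_is_linear i).

Lemma pderivLE (n : nat) (i : 'I_n) (S : {set 'I_n}) :
  pderivL i (monom S) = pderivL_monom i S.
Proof.
rewrite /pderivL (bigD1 S) //= big1 => [|T /negbTE neTS].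
  by rewrite ffunE eqxx scale1r addr0.
by rewrite ffunE neTS scale0r.
Qed.

Definition alpha_plus (n : nat) (i : 'I_n) : 'End(extalg n) :=
  linfun (wedge_left i).

Definition alpha_minus (n : nat) (i : 'I_n) : 'End(extalg n) :=
  linfun (pderivL i).

(* Main.v *)
Require Import Defs.
From mathcomp Require Import all_boot all_order all_algebra.
Import GRing.Theory.
Local Open Scope ring_scope.

(** The first relation is the polarization of [v * v = 0] at
    [v = phi i + phi j].

    The third one ([alpha_plus_minus]) is checked on monomials.  Where they do
    not vanish, both operators of index [i] send [monom S] to a monomial, with
    the sign [(-1) ^+ m], where [m] counts the elements of [S] below [i]
    ([phi_mul_monom], [pderivL_monomE]).  When [i != j], the two compositions
    are either both zero on [monom S] or opposite to each other, because
    adding or removing the smaller index changes the count for the larger one;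
    when [i = j], exactly one of the two compositions is nonzero on [monom S],
    and its sign occurs squared.

    The second relation then follows formally: by the third one, the
    anticommutator of two derivatives commutes with every multiplication by
    [phi k]; it kills [1], hence all products of the [phi k], that is, all
    monomials. *)

Lemma eq_lfun_monom (n : nat) (f g : 'End(extalg n)) :
  (forall S, f (monom S) = g (monom S)) -> f = g.
Proof.
move=> fg; apply/lfunP => P; rewrite (extalg_decomp P) 2!linear_sum.
by apply: eq_bigr => S _; rewrite 2!linearZ /= fg.
Qed.

Lemma alpha_plusE (n : nat) (i : 'I_n) (P : extalg n) :
  alpha_plus i P = phi i * P.
Proof. exact: lfunE. Qed.

Lemma alpha_minusE (n : nat) (i : 'I_n) (P : extalg n) :
  alpha_minus i P = pderivL i P.
Proof. exact: lfunE. Qed.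

Definition alpha_opE := (alpha_plusE, alpha_minusE).

Lemma inversions_set1l (n : nat) (i : 'I_n) (S : {set 'I_n}) :
  inversions [set i] S = (\sum_(j in S) (j < i))%N.
Proof. by rewrite /inversions big_set1. Qed.

Lemma inversions_set11 (n : nat) (i j : 'I_n) :
  inversions [set i] [set j] = (j < i)%N.
Proof. by rewrite inversions_set1l big_set1. Qed.

Lemma inversions_setU1r (n : nat) (i j : 'I_n) (S : {set 'I_n}) :
  j \notin S ->
  inversions [set i] (j |: S) = ((j < i) + inversions [set i] S)%N.
Proof. by move=> jS; rewrite inversionsUr ?disjoints1 // inversions_set11. Qed.

Lemma index_enum_set (n : nat) (i : 'I_n) (S : {set 'I_n}) :
  i \in S -> index i (enum S) = inversions [set i] S.
Proof.
rewrite inversions_set1l -big_enum -mem_enum /=.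
elim: (enum S) (@sorted_enum_ord n S) => [|k ks IH] //= kks.
have /allP ltk : all (fun j : 'I_n => (k < j)%N) ks.
  by apply: order_path_min kks; move=> ? ? ?; apply: ltn_trans.
rewrite inE big_cons; have [-> _|ne_ik /= iks] := eqVneq i k.
  rewrite ltnn big_seq big1 ?eqxx // => j /ltk.
  by rewrite ltnNge => /negbTE; rewrite leq_eqVlt => /norP[_ /negbTE->].
by rewrite (ltk _ iks) IH ?(path_sorted kks).
Qed.

Lemma phi_mul_monom (n : nat) (i : 'I_n) (S : {set 'I_n}) :
  phi i * monom S =
  if i \in S then 0 else (-1) ^+ inversions [set i] S *: monom (i |: S).
Proof.
rewrite phiE [_ * _]wedge_monom /wedge_sign disjoints1.
by case: (i \in S); rewrite ?scale0r.
Qed.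

Lemma pderivL_monomE (n : nat) (i : 'I_n) (S : {set 'I_n}) :
  pderivL i (monom S) =
  if i \in S then (-1) ^+ inversions [set i] S *: monom (S :\ i) else 0.
Proof.
by rewrite pderivLE /pderivL_monom; case: ifP => // /index_enum_set->.
Qed.

Lemma pderivL1 (n : nat) (i : 'I_n) : pderivL i 1 = 0.
Proof. by rewrite pderivL_monomE inE. Qed.

Lemma phi_anticomm (n : nat) (i j : 'I_n) : phi i * phi j + phi j * phi i = 0.
Proof.
have sq0 (k : 'I_n) : phi k * phi k = 0 by apply: ext_incl_sq.
have := ext_incl_sq (delta_mx 0 i + delta_mx 0 j).
have -> : ext_incl (delta_mx 0 i + delta_mx 0 j) = phi i + phi j.
  rewrite /phi /ext_incl -big_split; apply: eq_bigr => k _.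
  by rewrite mxE scalerDl.
by rewrite mulrDl !mulrDr (sq0 i) (sq0 j) add0r addr0.
Qed.

(** The monomial case of the third relation, for distinct indices. *)
Lemma phi_pderivL_monom_neq (n : nat) (i j : 'I_n) (S : {set 'I_n}) :
  i != j -> phi i * pderivL j (monom S) + pderivL j (phi i * monom S) = 0.
Proof.
move=> ne_ij; have [jS|jS] := boolP (j \in S); last first.
  rewrite pderivL_monomE (negbTE jS) mulr0 add0r phi_mul_monom.
  case: ifP => _; first by rewrite linear0.
  rewrite linearZ /= pderivL_monomE in_setU1 eq_sym (negbTE ne_ij) (negbTE jS).
  exact: scaler0.
have jT : j \notin S :\ j by rewrite setD11.
rewrite -(setD1K jS); move: (S :\ j) jT => T jT.
rewrite pderivL_monomE setU11 setU1K // inversions_setU1r // ltnn add0n.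
rewrite -scalerAr !phi_mul_monom in_setU1 (negbTE ne_ij) /=.
have [iT|iT] := boolP (i \in T); first by rewrite !linear0 addr0.
have jiT : j \notin i |: T by rewrite in_setU1 eq_sym (negbTE ne_ij).
rewrite [X in _ + X]linearZ /= setUCA pderivL_monomE setU11 setU1K //.
rewrite !inversions_setU1r // ltnn add0n !scalerA -scalerDl.
(* Exactly one of [i < j] and [j < i] holds. *)
have -> : (i < j)%N = ~~ (j < i)%N.
  by rewrite -leqNgt [RHS]leq_eqVlt val_eqE (negbTE ne_ij).
rewrite !exprD; set x := _ ^+ inversions _ _; set y := _ ^+ inversions _ _.
by case: (j < i)%N; rewrite /= expr0 expr1 ?mul1r mulN1r ?mulNr ?mulrN;
  rewrite mulrC subrr scale0r.
Qed.

Lemma phi_pderivL_monom_eq (n : nat) (i : 'I_n) (S : {set 'I_n}) :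
  phi i * pderivL i (monom S) + pderivL i (phi i * monom S) = monom S.
Proof.
rewrite phi_mul_monom pderivL_monomE.
have [iS|iS] := boolP (i \in S).
  rewrite linear0 addr0 -scalerAr phi_mul_monom setD11 scalerA setD1K //.
  rewrite -{1}(setD1K iS) inversions_setU1r ?setD11 // ltnn add0n.
  by rewrite -expr2 sqrr_sign scale1r.
rewrite mulr0 add0r linearZ /= pderivL_monomE setU11 scalerA setU1K //.
by rewrite inversions_setU1r // ltnn add0n -expr2 sqrr_sign scale1r.
Qed.

Lemma alpha_plus_minus (n : nat) (i j : 'I_n) :
  (alpha_plus i \o alpha_minus j)%VF + (alpha_minus j \o alpha_plus i)%VF
  = (i == j)%:R *: \1%VF.
Proof.
apply: eq_lfun_monom => S.
rewrite add_lfunE scale_lfunE id_lfunE !comp_lfunE !alpha_opE.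
have [->|ne_ij] := eqVneq i j; first by rewrite phi_pderivL_monom_eq scale1r.
by rewrite phi_pderivL_monom_neq // scale0r.
Qed.

(** The third relation evaluated at [P], in the form of a twisted Leibniz
    rule. *)
Lemma pderivL_mul_phi (n : nat) (i j : 'I_n) (P : extalg n) :
  pderivL j (phi i * P) = (i == j)%:R *: P - phi i * pderivL j P.
Proof.
have /lfunP/(_ P) := alpha_plus_minus n i j.
rewrite add_lfunE scale_lfunE id_lfunE !comp_lfunE !alpha_opE => <-.
by rewrite addrC addKr.
Qed.

Lemma alpha_minus_anticomm (n : nat) (i j : 'I_n) :
  (alpha_minus i \o alpha_minus j)%VF + (alpha_minus j \o alpha_minus i)%VF = 0.
Proof.
(* Two applications of the Leibniz rule: the part without derivatives of second
   order is antisymmetric in [i'] and [j']. *)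
have twist (k i' j' : 'I_n) (Q : extalg n) :
    pderivL i' (pderivL j' (phi k * Q)) = (k == j')%:R *: pderivL i' Q
      - (k == i')%:R *: pderivL j' Q + phi k * pderivL i' (pderivL j' Q).
  rewrite pderivL_mul_phi (linearB (pderivL i')) [X in X - _]linearZ /=.
  by rewrite pderivL_mul_phi opprB addrA addrAC.
(* The anticommutator commutes with multiplication by [phi k]. *)
have commD (k : 'I_n) (Q : extalg n) :
    pderivL i (pderivL j (phi k * Q)) + pderivL j (pderivL i (phi k * Q))
    = phi k * (pderivL i (pderivL j Q) + pderivL j (pderivL i Q)).
  rewrite !twist mulrDr addrACA -[X in _ + X + _]opprB subrr.
  exact: add0r.
apply: eq_lfun_monom => S.
rewrite add_lfunE [RHS]zero_lfunE !comp_lfunE !alpha_opE.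
rewrite monomE; elim: (enum S) => [|k ks IH].
  by rewrite big_nil !pderivL1 !linear0 addr0.
by rewrite big_cons commD IH mulr0.
Qed.

Theorem theorem4p3 (n : nat) (hn : (1 <= n)%N) (i j : 'I_n) :
  [/\ (alpha_plus i \o alpha_plus j)%VF + (alpha_plus j \o alpha_plus i)%VF = 0,
      (alpha_minus i \o alpha_minus j)%VF + (alpha_minus j \o alpha_minus i)%VF = 0 &
      (alpha_plus i \o alpha_minus j)%VF + (alpha_minus j \o alpha_plus i)%VF
        = (i == j)%:R *: \1%VF].
Proof.
split; [|exact: alpha_minus_anticomm|exact: alpha_plus_minus].
apply/lfunP => P; rewrite add_lfunE [RHS]zero_lfunE !comp_lfunE !alpha_opE.
by rewrite !mulrA -mulrDl phi_anticomm mul0r.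
Qed.
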